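(* For any real-valued function $r(N)$ of the positive integer $N$ with $\lim_{N\to\infty}r(N)=\infty$ we have $$E_N^{lin-exp-sym}\ge 2^{N/2-r(N)+o(1)}.$$ Moreover, we have $$E_N^{lin-sym}\ge\frac{N}{2}-\log(N)+o(1).$$ Here $o(1)$ denotes a function of $N$ tending to $0$ as $N\to\infty$ (in the first bound it may depend on the function $r$).
   Context: For a binary vector $\mathcal{S}_N=(s_0,\ldots,s_{N-1})\in\{0,1\}^N$, regarded over the field $\mathbb{F}_2$, the $N$th linear complexity $L(\mathcal{S}_N)$ is the smallest integer $L\ge 0$ for which there are $c_0,\ldots,c_L\in\mathbb{F}_2$ with $c_L=1$ such that $$\sum_{\ell=0}^L c_\ell s_{n+\ell}=0,\quad n=0,1,\ldots,N-L-1$$ (the condition is vacuous for $L=N$; the zero vector has $L=0$). The reverse of $\mathcal{S}_N$ is $\mathcal{S}_N^{rev}=(s_{N-1},s_{N-2},\ldots,s_0)$ and the $N$th symmetric linear complexity is $L^{sym}(\mathcal{S}_N)=\min\{L(\mathcal{S}_N),L(\mathcal{S}_N^{rev})\}$. The expected values are $$E_N^{lin-sym}=2^{-N}\sum_{\mathcal{S}_N\in\{0,1\}^N}L^{sym}(\mathcal{S}_N),\qquad E_N^{lin-exp-sym}=2^{-N}\sum_{\mathcal{S}_N\in\{0,1\}^N}2^{L^{sym}(\mathcal{S}_N)}.$$ $\log$ denotes the natural logarithm. *)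

(* Defs.v *)
From mathcomp Require Import all_boot all_order all_algebra.
From mathcomp Require Import all_classical all_reals all_analysis.

Set Implicit Arguments.
Unset Strict Implicit.
Unset Printing Implicit Defensive.

Import Order.TTheory GRing.Theory Num.Theory.
Import numFieldNormedType.Exports.

Local Open Scope ring_scope.

(* All indices n + l below are < N, so the default value of S`_i is never used;
   'I_(N - L) is empty when N <= L, which makes the condition vacuous. *)
Definition has_recurrence (N : nat) (S : N.-tuple 'F_2) (L : nat) : bool :=
  [exists c : {ffun 'I_L.+1 -> 'F_2}, (c ord_max == 1) &&
    [forall n : 'I_(N - L), \sum_(l < L.+1) c l * S`_(n + l) == 0]].

Lemma has_recurrence_ex (N : nat) (S : N.-tuple 'F_2) :
  exists L, has_recurrence S L.
Proof.
exists N; apply/existsP; exists [ffun=> 1]; rewrite ffunE eqxx /=.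
by apply/forallP => -[n]; rewrite subnn.
Qed.

Definition lin_complexity (N : nat) (S : N.-tuple 'F_2) : nat :=
  ex_minn (has_recurrence_ex S).

Definition sym_lin_complexity (N : nat) (S : N.-tuple 'F_2) : nat :=
  minn (lin_complexity S) (lin_complexity (rev_tuple S)).

Definition E_lin_sym (R : realType) (N : nat) : R :=
  2 ^- N * \sum_(S : N.-tuple 'F_2) (sym_lin_complexity S)%:R.

Definition E_lin_exp_sym (R : realType) (N : nat) : R :=
  2 ^- N * \sum_(S : N.-tuple 'F_2) 2 ^+ sym_lin_complexity S.

(* Main.v *)
Require Import Defs.
From mathcomp Require Import all_boot all_order all_algebra.
From mathcomp Require Import all_classical all_reals all_analysis.
From mathcomp Require Import zify lra.
Import Order.TTheory GRing.Theory Num.Theory.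
Import numFieldNormedType.Exports.
Local Open Scope classical_set_scope.
Local Open Scope ring_scope.

(** A sequence of linear complexity at most [k] is determined by a recurrence of
    order [k] and by its first [k] terms. Hence at most [4 ^ k.+1] sequences have
    symmetric linear complexity at most [k], a proportion decaying geometrically
    as [k] decreases from [N / 2]. Both expectations therefore lose only a bounded
    amount (in the exponent, for the first one): they are at least
    [2 `^ (N / 2 - 3)] and [N / 2 - 3]. *)

(* The recurrence of order [L] is multiplied by the monomial of degree [M - L]. *)
Lemma has_recurrence_leq {N} (S : N.-tuple 'F_2) {L M : nat} :
  (L <= M)%N -> has_recurrence S L -> has_recurrence S M.
Proof.
move=> LM /existsP[c /andP[/eqP cmax /forallP crec]].
pose d : {ffun 'I_M.+1 -> 'F_2} :=
  [ffun l : 'I_M.+1 => if (l < M - L)%N then 0 else c (inord (l - (M - L)))].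
apply/existsP; exists d; apply/andP; split.
  rewrite ffunE /= ltnNge leq_subr /= subKn //.
  by rewrite -cmax; apply/eqP; congr (c _); apply: val_inj; rewrite /= inordK.
apply/forallP => -[n nN] /=.
(* The [M - L] lowest coefficients of [d] vanish, so its relation at [n] is the relation of [c] at
   [n + (M - L)]. *)
have nN' : (n + (M - L) < N - L)%N by lia.
rewrite -[X in _ == X](eqP (crec (Ordinal nN'))) /=.
pose F i : 'F_2 := (if (i < M - L)%N then 0 else c (inord (i - (M - L)))) * S`_(n + i).
rewrite (eq_bigr (fun l : 'I_M.+1 => F l)) => [|l _]; last by rewrite ffunE.
rewrite -(big_mkord xpredT F) (big_cat_nat _ (n := M - L)) //=; last by lia.
rewrite big_nat big1 ?add0r => [|i /andP[_ ilt]]; last by rewrite /F ilt mul0r.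
rewrite -{1}[(M - L)%N]add0n big_addn.
have -> : (M.+1 - (M - L) = L.+1)%N by lia.
rewrite big_mkord; apply/eqP; apply: eq_bigr => l _.
rewrite /F ltnNge leq_addl /= addnK inord_val.
by congr (_ * S`_ _); lia.
Qed.

Lemma lin_complexity_leq {N} (S : N.-tuple 'F_2) (k : nat) :
  (lin_complexity S <= k)%N = has_recurrence S k.
Proof.
rewrite /lin_complexity; case: ex_minnP => L SL Lmin.
by apply/idP/idP => [/has_recurrence_leq|/Lmin//]; apply.
Qed.

(** As the leading coefficient is 1, the relation at [i - k] expresses the term of index [i] through
    the [k] preceding ones; strong induction on [i] concludes. *)
Lemma recurrence_determines {N} {k : nat} {c : {ffun 'I_k.+1 -> 'F_2}}
    {S T : N.-tuple 'F_2} :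
  c ord_max = 1 ->
  (forall n : 'I_(N - k), \sum_(l < k.+1) c l * S`_(n + l) = 0) ->
  (forall n : 'I_(N - k), \sum_(l < k.+1) c l * T`_(n + l) = 0) ->
  (forall i : 'I_k, S`_i = T`_i) -> S = T.
Proof.
move=> cmax Srec Trec eqk.
suff eqN i : (i < N)%N -> S`_i = T`_i.
  apply: val_inj; apply: (@eq_from_nth _ 0) => [|i]; first by rewrite !size_tuple.
  by rewrite size_tuple => /eqN.
elim/ltn_ind: i => i IH iN.
have [ik|ki] := ltnP i k; first exact: (eqk (Ordinal ik)).
have nN : (i - k < N - k)%N by lia.
have := etrans (Srec (Ordinal nN)) (esym (Trec (Ordinal nN))).
rewrite !big_ord_recr /= cmax.
rewrite !mul1r subnK //.
rewrite (eq_bigr (fun l => c (widen_ord (leqnSn k) l) * T`_(i - k + l))).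
  by move/addrI.
by move=> l _; rewrite IH //; have := ltn_ord l; lia.
Qed.

(** The pairs of a coefficient vector and [k] initial terms number [2 ^ k.+1 * 2 ^ k]; leaving the
    leading coefficient free costs only a factor 2. *)
Lemma card_has_recurrence (N k : nat) :
  (#|[set S : N.-tuple 'F_2 | has_recurrence S k]%SET| <= 2 ^ (2 * k).+1)%N.
Proof.
pose rec (S : N.-tuple 'F_2) (c : {ffun 'I_k.+1 -> 'F_2}) :=
  (c ord_max == 1) &&
    [forall n : 'I_(N - k), \sum_(l < k.+1) c l * S`_(n + l) == 0].
(* One recurrence is picked for each [S]; the default [[ffun=> 0]] is never reached on the sequences
   being counted. *)
pose f (S : N.-tuple 'F_2) :=
  (odflt [ffun=> 0] [pick c | rec S c], [ffun i : 'I_k => S`_i]).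
have recP S : has_recurrence S k -> rec S (f S).1.
  move=> /existsP[c cS]; rewrite /f /=.
  by case: pickP => [//|/(_ c)]; rewrite /rec cS.
have f_inj : {in [set S : N.-tuple 'F_2 | has_recurrence S k]%SET &, injective f}.
  move=> S T; rewrite !inE => /recP recS /recP recT eqf.
  move: recT; rewrite -eqf => /andP[_ /forallP recT].
  move: recS => /andP[/eqP cmax /forallP recS].
  apply: (recurrence_determines cmax) => [n|n|i].
  - exact/eqP/recS.
  - exact/eqP/recT.
  - by move: (congr1 snd eqf) => /ffunP/(_ i); rewrite !ffunE.
rewrite -(card_in_imset f_inj); apply: leq_trans (max_card _) _.
by rewrite card_prod !card_ffun !card_ord -expnD leq_exp2l //; lia.
Qed.

(** Either [S] or its reverse has a recurrence of order [k]. Reversal is injective, so the union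
    bound just doubles [2 ^ (2 * k).+1]. *)
Lemma card_sym_lin_complexity_leq (N k : nat) :
  (#|[set S : N.-tuple 'F_2 | (sym_lin_complexity S <= k)%N]%SET| <= 4 ^ k.+1)%N.
Proof.
set A := [set S : N.-tuple 'F_2 | has_recurrence S k]%SET.
have rev_inj : injective (fun S : N.-tuple 'F_2 => rev_tuple S).
  by move=> S T /(congr1 val) /= /(can_inj revK)/val_inj.
apply: leq_trans (_ : (#|A :|: (fun S => rev_tuple S) @^-1: A| <= _)%N).
  apply: subset_leq_card; apply/fintype.subsetP => S.
  by rewrite !inE /sym_lin_complexity geq_min !lin_complexity_leq.
rewrite (leq_trans (leq_card_setU _ _)) // card_preimset //.
rewrite (leq_trans (leq_add (card_has_recurrence N k) (card_has_recurrence N k))) //.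
by rewrite addnn -mul2n -expnS -(expnM 2 2 k.+1) leq_exp2l //; lia.
Qed.

(** Layer counting: the shortfall of [L S] below [N./2] is the number of levels [k < N./2] with
    [L S <= k]. Summed over [S], it is at most a geometric sum of powers of 4, dominated by its last
    term. *)
Lemma sum_sym_lin_complexity (N : nat) :
  (N./2 * 2 ^ N <=
    \sum_(S : N.-tuple 'F_2) sym_lin_complexity S + 2 * 2 ^ N)%N.
Proof.
set L := @sym_lin_complexity N.
have layers S : (N./2 <= L S + \sum_(k < N./2) (L S <= k))%N.
  elim: (N./2) => // K IH; rewrite big_ord_recr /=.
  by case: (leqP (L S) K) => h; rewrite ?addn0 ?addn1 ?addnS ?ltnS ?ltn_addr.
have geom K : (\sum_(k < K) 4 ^ k.+1 <= 2 * 4 ^ K)%N.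
  elim: K => [|K IH]; first by rewrite big_ord0.
  by rewrite big_ord_recr /= (leq_trans (leq_add IH (leqnn _))) // expnS; lia.
have half : (4 ^ N./2 <= 2 ^ N)%N by rewrite -(expnM 2 2) leq_exp2l //; lia.
have cardT : #|{: N.-tuple 'F_2}| = (2 ^ N)%N by rewrite card_tuple card_ord.
have -> : (N./2 * 2 ^ N = \sum_(S : N.-tuple 'F_2) N./2)%N.
  by rewrite sum_nat_const cardT mulnC.
apply: leq_trans (leq_sum _ (fun S _ => layers S)) _.
rewrite big_split /= leq_add2l exchange_big /=.
apply: leq_trans (leq_trans (geom N./2) _); last by rewrite leq_mul2l half.
apply: leq_sum => k _; apply: leq_trans (card_sym_lin_complexity_leq N k).
rewrite -sum1dep_card [leqRHS]big_mkcond; apply: leq_sum => S _.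
by rewrite -/(L S); case: (L S <= k)%N.
Qed.

(** At least half of all sequences have complexity at least [K], and these alone give the bound. *)
Lemma sum_exp_sym_lin_complexity (N : nat) : (0 < N)%N ->
  (2 ^ (N./2).-1 * 2 ^ N <=
    2 * \sum_(S : N.-tuple 'F_2) 2 ^ sym_lin_complexity S)%N.
Proof.
move=> N0; set K := (N./2).-1; set L := @sym_lin_complexity N.
have cardT : #|{: N.-tuple 'F_2}| = (2 ^ N)%N by rewrite card_tuple card_ord.
have lt_card : (#|[set S | (L S < K)%N]%SET| <= 4 ^ K)%N.
  case: K => [|k]; last exact: card_sym_lin_complexity_leq.
  by rewrite (eq_card0 (A := _)) // => S; rewrite inE.
(* This amounts to [2 * K + 1 <= N], which also holds at [N = 1], where the truncated predecessor
   gives [K = 0]. *)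
have half : (2 * 4 ^ K <= 2 ^ N)%N.
  by rewrite -(expnM 2 2) -expnS leq_exp2l // /K; lia.
have ge_card : (2 ^ N <= 2 * #|[set S | (K <= L S)%N]%SET|)%N.
  have := cardsC [set S | (K <= L S)%N]%SET; rewrite cardT.
  have -> : ~: [set S | (K <= L S)%N]%SET = [set S | (L S < K)%N]%SET.
    by apply/setP => S; rewrite !inE ltnNge.
  lia.
apply: leq_trans (_ : (2 * (2 ^ K * #|[set S | (K <= L S)%N]%SET|) <= _)%N).
  by rewrite mulnCA leq_mul2l ge_card orbT.
rewrite leq_mul2l /= mulnC -sum_nat_const big_mkcond /=.
by apply: leq_sum => S _; rewrite inE; case: (leqP K (L S)) => // KL; rewrite leq_exp2l.
Qed.

Lemma half_ge (R : realType) (N : nat) : N%:R / 2 - 1 / 2 <= (N./2)%:R :> R.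
Proof.
rewrite -{1}(odd_double_half N) natrD -mul2n natrM.
by case: (odd N) => /=; lra.
Qed.

(** The loss is 2 from the low layers and at most 1/2 from rounding [N / 2]; 3 is a convenient upper
    bound. *)
Lemma E_lin_sym_ge (R : realType) (N : nat) : N%:R / 2 - 3 <= E_lin_sym R N.
Proof.
have := sum_sym_lin_complexity N.
rewrite -(ler_nat R) natrD !natrM natrX natr_sum -lerBlDr -mulrBl => sum_ge.
rewrite /E_lin_sym [leRHS]mulrC ler_pdivlMr ?exprn_gt0 //.
apply: le_trans sum_ge; rewrite ler_pM2r ?exprn_gt0 //.
by have := half_ge R N; lra.
Qed.

Lemma E_lin_exp_sym_ge (R : realType) (N : nat) : (0 < N)%N ->
  2 `^ (N%:R / 2 - 3) <= E_lin_exp_sym R N.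
Proof.
move=> /sum_exp_sym_lin_complexity.
rewrite -(ler_nat R) !natrM !natrX natr_sum => sum_ge.
apply: (@le_trans _ _ (2 ^+ (N./2).-1 / 2)); last first.
  rewrite /E_lin_exp_sym [leRHS]mulrC ler_pdivlMr ?exprn_gt0 //.
  rewrite mulrAC ler_pdivrMr // [leRHS]mulrC.
  by under eq_bigr => S _ do rewrite -natrX.
have <- : 2 `^ ((N./2).-1%:R - 1) = 2 ^+ (N./2).-1 / 2 :> R.
  by rewrite powRB ?pnatr_eq0 ?implybT // powRr1 ?ler0n // powR_mulrn.
rewrite ler_powR ?ler1n //.
(* An inequality, since the predecessor is truncated when [N./2 = 0]. *)
have : (N./2)%:R <= (N./2).-1.+1%:R :> R by rewrite ler_nat; lia.
by rewrite -addn1 natrD; have := half_ge R N; lra.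
Qed.

(** This supplies the [o(1)] terms: the minimum is eventually 0, yet never exceeds [u N - C], so it
    also covers the small [N] where [u N < C]. *)
Lemma cvg_min0_sub (R : realType) (u : nat -> R) (C : R) :
  u N @[N --> \oo] --> +oo ->
  Num.min 0 (u N - C) @[N --> \oo] --> (0 : R).
Proof.
move=> /cvgryPge/(_ C) uC; apply: cvg_near_cst.
by near=> N; apply/min_idPl; rewrite subr_ge0; near: N.
Unshelve. all: by end_near. Qed.

Lemma cvg_ln_nat (R : realType) : ln N%:R @[N --> \oo] --> (+oo : set_system R).
Proof.
apply/cvgryPge => A; near=> N.
rewrite -[A]expRK ler_ln ?posrE ?expR_gt0 //; last first.
  by rewrite (lt_le_trans (expR_gt0 A)) //; near: N; exact: nbhs_infty_ger.
by near: N; exact: nbhs_infty_ger.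
Unshelve. all: by end_near. Qed.

Theorem theorem3 (R : realType) :
  (forall r : nat -> R, r N @[N --> \oo] --> +oo ->
     exists eps : nat -> R, eps N @[N --> \oo] --> (0 : R) /\
       forall N : nat, (0 < N)%N ->
         2 `^ (N%:R / 2 - r N + eps N) <= E_lin_exp_sym R N) /\
  (exists eps : nat -> R, eps N @[N --> \oo] --> (0 : R) /\
     forall N : nat, (0 < N)%N ->
       N%:R / 2 - ln N%:R + eps N <= E_lin_sym R N).
Proof.
split=> [r r_oo|].
  (* The constant 3 is that of [E_lin_exp_sym_ge]: the exponent becomes at most [N / 2 - 3] for
     every [N]. *)
  exists (fun N => Num.min 0 (r N - 3)); split; first exact: cvg_min0_sub.
  move=> N N0; apply: le_trans (E_lin_exp_sym_ge R N N0).
  rewrite ler_powR ?ler1n //.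
  have : Num.min 0 (r N - 3) <= r N - 3 by rewrite ge_min lexx orbT.
  lra.
exists (fun N => Num.min 0 (ln N%:R - 3)); split.
  exact/cvg_min0_sub/cvg_ln_nat.
move=> N _; apply: le_trans (E_lin_sym_ge R N).
have : Num.min 0 (ln N%:R - 3) <= ln N%:R - 3 :> R by rewrite ge_min lexx orbT.
lra.
Qed.
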